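(* (The First Rogers-Ramanujan Identity.) Let $K$ be a totally real number field and $\mathcal O^+$ the set of totally positive algebraic integers of $K$. For every $\delta\in\mathcal O^+$, the partitions of $\delta$ in which the scale of each part is congruent to $1$ or $4$ modulo $5$ are equinumerous with the partitions $\lambda=(\lambda_1,\ldots,\lambda_r)$ of $\delta$ in which the difference between the scales of any two parts in the same section is at least $2$ (i.e. $|s(\lambda_a)-s(\lambda_b)|\ge2$ whenever $a\ne b$ and $t(\lambda_a)=t(\lambda_b)$).
   Context: A partition of $\delta\in\mathcal O^+$ is a finite sequence $\lambda=(\lambda_1,\ldots,\lambda_r)$ of elements of $\mathcal O^+$ (the parts) with $\lambda_1+\cdots+\lambda_r=\delta$; partitions are considered (and counted) up to change of order, i.e. as multisets. Each $\delta\in\mathcal O^+$ has only finitely many partitions. An element $\gamma\in\mathcal O^+$ is primitive if $\gamma\notin n\mathcal O^+$ for every rational integer $n\ge 2$. Every $\delta\in\mathcal O^+$ can be written uniquely as $\delta=s(\delta)t(\delta)$ with $s(\delta)\in\mathbb Z^+$ (the scale) and $t(\delta)$ primitive (the primitive factor). Two elements of $\mathcal O^+$ are in the same section if they have the same primitive factor. *)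

(* Defs.v *)
From HB Require Import structures.
From mathcomp Require Import all_boot all_order all_algebra all_field.
From mathcomp Require Import finmap multiset.
From mathcomp Require Import boolp classical_sets functions cardinality.

Set Implicit Arguments.
Unset Strict Implicit.
Unset Printing Implicit Defensive.

Import Order.TTheory GRing.Theory Num.Theory.
Local Open Scope classical_set_scope.
Local Open Scope mset_scope.
Local Open Scope ring_scope.

(* A number field is a [K : fieldExtType rat].  Its elements being algebraic,
   its embeddings into the complex numbers are those into [algC]. *)
Definition totally_real (K : fieldExtType rat) : Prop :=
  forall (sigma : {rmorphism K -> algC}) (x : K), sigma x \is Num.real.

(* In [algC], [0 < z] means that [z] is real and positive. *)
Definition totally_positive (K : fieldExtType rat) (x : K) : Prop :=
  forall sigma : {rmorphism K -> algC}, 0 < sigma x.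

Definition Oplus (K : fieldExtType rat) : set K :=
  [set x | integralOver (intr : int -> K) x /\ totally_positive x].

Definition primitive (K : fieldExtType rat) (x : K) : Prop :=
  Oplus x /\
  forall n : nat, (2 <= n)%N -> ~ (exists2 y, Oplus y & x = n%:R * y).

(* The pair (s(x), t(x)).  For [x] in [Oplus K] there is exactly one pair with
   the stated property; for other [x] there is none and the value is (0, 0). *)
Definition scale_primitive (K : fieldExtType rat) (x : K) : nat * K :=
  xget (0%N, 0)
    [set st | [/\ (0 < st.1)%N, primitive st.2 & x = st.1%:R * st.2]].

Definition scale (K : fieldExtType rat) (x : K) : nat :=
  (scale_primitive x).1.

Definition primitive_factor (K : fieldExtType rat) (x : K) : K :=
  (scale_primitive x).2.

Definition same_section (K : fieldExtType rat) (x y : K) : Prop :=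
  primitive_factor x = primitive_factor y.

Definition is_partition (K : fieldExtType rat) (delta : K)
    (lambda : {mset K}) : Prop :=
  (forall x, x \in lambda -> Oplus x) /\ \sum_(x <- lambda) x = delta.

Definition scales_1_or_4_mod_5 (K : fieldExtType rat)
    (lambda : {mset K}) : Prop :=
  forall x, x \in lambda -> scale x = 1 %[mod 5] \/ scale x = 4 %[mod 5].

(* [a] and [b] index the enumeration of the multiset, in which parts are
   repeated according to their multiplicity; [`|m - n|%N] is the absolute
   difference (the subtraction is in [int]). *)
Definition section_scales_2_apart (K : fieldExtType rat)
    (lambda : {mset K}) : Prop :=
  forall a b : nat, (a < size lambda)%N -> (b < size lambda)%N -> a <> b ->
    same_section lambda`_a lambda`_b ->
    (2 <= `|scale lambda`_a - scale lambda`_b|)%N.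

(* Main.v *)
From HB Require Import structures.
Require Import Defs.
From mathcomp Require Import all_boot all_order all_algebra all_field.
From mathcomp Require Import finmap multiset.
From mathcomp Require Import boolp classical_sets functions cardinality.
From mathcomp Require Import zify ring.

(* Writing a part as scale times primitive factor splits a partition of [delta]
   into one integer partition for each primitive element, and conversely.  Hence
   a sum-preserving bijection between the two kinds of integer partitions of the
   classical identity, applied in every section, gives the bijection sought.

   The classical identity is Schur's argument.  The generating polynomial of
   partitions with gaps at least 2 and parts less than [n] satisfies the
   recurrence [E (n+2) = E (n+1) + q^(n+1) E n], and so does
   [sum_j (-1)^j q^(j(5j+1)/2) [n; floor((n-5j)/2)]_q].  Letting [n] grow and
   comparing with a finite form of the Jacobi triple product in base [q^5] gives
   the product over parts congruent to 1 or 4 modulo 5.  Power series are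
   replaced by polynomials modulo [X^M]. *)

Set Implicit Arguments.
Unset Strict Implicit.
Unset Printing Implicit Defensive.

Import Order.TTheory GRing.Theory Num.Theory.

(** * Gaussian binomials and finite identities *)

Section GaussianBinomial.
Local Open Scope ring_scope.
Variables (R : comNzRingType) (x : R).

(** Gaussian binomial coefficients in base [x]. The integer lower index allows free shifts of
    summation, since the value vanishes outside [0 <= k <= n]; hence [|k|] in the exponent matters
    only for [k >= 0]. *)
Fixpoint gauss (n : nat) (k : int) : R :=
  if n is m.+1 then gauss m (k - 1) + x ^+ `|k| * gauss m k else (k == 0)%:R.

Lemma gauss_lt0 n k : k < 0 -> gauss n k = 0.
Proof.
elim: n k => [|n IH] k k0 /=; first by rewrite lt_eqF.
by rewrite !IH ?mulr0 ?addr0 //; lia.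
Qed.

Lemma gauss_gt n k : n%:Z < k -> gauss n k = 0.
Proof.
elim: n k => [|n IH] k nk /=; first by rewrite gt_eqF.
by rewrite !IH ?mulr0 ?addr0 //; lia.
Qed.

(** Exponents below are absolute values of integers; they have to agree only where the coefficient
    does not vanish. *)
Lemma eq_mul_gauss n k (y z : R) :
  (0 <= k -> k <= n%:Z -> y = z) -> y * gauss n k = z * gauss n k.
Proof.
move=> yz; have [k0|k0] := ltP k 0; first by rewrite gauss_lt0 ?mulr0.
have [nk|kn] := ltP n%:Z k; first by rewrite gauss_gt ?mulr0.
by rewrite yz.
Qed.

Lemma gaussS n k : gauss n.+1 k = gauss n (k - 1) + x ^+ `|k| * gauss n k.
Proof. by []. Qed.

(** The second Pascal rule. After expanding both sides, the two cross terms carry the same total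
    power of [x]. *)
Lemma gaussSr n k :
  gauss n.+1 k = gauss n k + x ^+ `|n.+1%:Z - k| * gauss n (k - 1).
Proof.
elim: n k => [|n IH] k.
  rewrite /= subr_eq0; have [->|k0] := eqVneq k 0; first by rewrite mul1r mulr0 addrC.
  by have [->|k1] := eqVneq k 1; rewrite ?mulr0 ?mulr1 ?addr0 ?add0r.
rewrite gaussS [in LHS]IH [in LHS](IH k) !gaussS !mulrDr.
have -> : n.+1%:Z - (k - 1) = n.+2%:Z - k by lia.
have -> : x ^+ `|k| * (x ^+ `|n.+1%:Z - k| * gauss n (k - 1))
        = x ^+ `|n.+2%:Z - k| * (x ^+ `|(k - 1)%R| * gauss n (k - 1)).
  rewrite !mulrA -!exprD; apply: eq_mul_gauss => h1 h2; congr (x ^+ _); lia.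
ring.
Qed.

(** The q-Pochhammer symbol [(x; x)_n]. *)
Definition qfact n : R := \prod_(i < n) (1 - x ^+ i.+1).

Lemma qfactS n : qfact n.+1 = qfact n * (1 - x ^+ n.+1).
Proof. by rewrite /qfact big_ord_recr. Qed.

Lemma gauss0 n : gauss n 0 = 1.
Proof.
by elim: n => [|n IH] //=; rewrite gauss_lt0 // IH mul1r add0r.
Qed.

Lemma gaussnn n : gauss n n%:Z = 1.
Proof.
elim: n => [|n IH] //.
rewrite gaussS (@gauss_gt n n.+1) ?mulr0 ?addr0; last by lia.
by have -> : n.+1%:Z - 1 = n%:Z by lia.
Qed.

(** The quotient formula for Gaussian binomials, free of division. The induction rests on [1 -
    x^(a+b+2) = (1 - x^(a+1)) + x^(a+1) (1 - x^(b+1))]. *)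
Lemma qfact_gauss a b : qfact a * qfact b * gauss (a + b) a%:Z = qfact (a + b).
Proof.
have [n] := ubnP (a + b); elim: n a b => // n IH [|a] [|b] le_n.
- by rewrite gauss0 /qfact !big_ord0 !mulr1.
- by rewrite gauss0 /qfact big_ord0 !mulr1 mul1r.
- by rewrite addn0 gaussnn /qfact big_ord0 !mulr1.
have := IH a.+1 b; have := IH a b.+1; rewrite !addnS !addSn => /(_ ltac:(lia)) h1 /(_ ltac:(lia)) h2.
rewrite gaussS (qfactS (a + b).+1).
have -> : a.+1%:Z - 1 = a%:Z by lia.
rewrite mulrDr [in X in X + _]qfactS.
have -> : qfact a * (1 - x ^+ a.+1) * qfact b.+1 * gauss (a + b).+1 a
          = (1 - x ^+ a.+1) * (qfact a * qfact b.+1 * gauss (a + b).+1 a) by ring.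
rewrite h1 [qfact b.+1]qfactS.
have -> : qfact a.+1 * (qfact b * (1 - x ^+ b.+1)) * (x ^+ `|a.+1%:Z| * gauss (a + b).+1 a.+1)
  = x ^+ a.+1 * (1 - x ^+ b.+1) * (qfact a.+1 * qfact b * gauss (a + b).+1 a.+1) by ring.
rewrite h2.
have -> : x ^+ (a + b).+2 = x ^+ a.+1 * x ^+ b.+1 by rewrite -exprD; congr (_ ^+ _); lia.
ring.
Qed.

End GaussianBinomial.

(** * Symmetric sums over an interval of integers *)

Section SymmetricSums.
Local Open Scope ring_scope.

(** The sum over [-L <= j <= L], a finite stand-in for a sum over all integers. *)
Definition zsum (V : zmodType) (L : nat) (F : int -> V) : V :=
  \sum_(i < L.*2.+1) F (i%:Z - L%:Z).

Lemma zsum_telescope (V : zmodType) L (T : int -> V) :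
  zsum L (fun j => T j - T (j + 1)) = T (- L%:Z) - T (L%:Z + 1).
Proof.
rewrite /zsum.
have -> : T (- L%:Z) - T (L%:Z + 1) =
   T (0%:Z - L%:Z) - T (L.*2.+1%:Z - L%:Z) by congr (T _ - T _); lia.
elim: (L.*2.+1) => [|n IH]; first by rewrite big_ord0 subrr.
rewrite big_ord_recr /= IH.
have -> : n%:Z - L%:Z + 1 = n.+1%:Z - L%:Z by lia.
by rewrite addrA subrK.
Qed.

Lemma eq_zsum (V : zmodType) L (F G : int -> V) :
  F =1 G -> zsum L F = zsum L G.
Proof. by move=> FG; apply: eq_bigr. Qed.

Lemma zsumD (V : zmodType) L (F G : int -> V) :
  zsum L (fun j => F j + G j) = zsum L F + zsum L G.
Proof. exact: big_split. Qed.

Lemma zsumB (V : zmodType) L (F G : int -> V) :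
  zsum L (fun j => F j - G j) = zsum L F - zsum L G.
Proof. by rewrite /zsum sumrB. Qed.

Lemma mulr_zsum (R : nzRingType) L (a : R) (F : int -> R) :
  a * zsum L F = zsum L (fun j => a * F j).
Proof. exact: mulr_sumr. Qed.

Lemma zsum_shift (V : zmodType) L (F : int -> V) :
  F (- L%:Z) = 0 -> F (L%:Z + 1) = 0 -> zsum L (fun j => F (j + 1)) = zsum L F.
Proof.
move=> F0 F1; apply/eqP; rewrite eq_sym -subr_eq0 -zsumB zsum_telescope.
by rewrite F0 F1 subrr.
Qed.

Lemma zsum_eq0 (V : zmodType) L (F : int -> V) :
  (forall j, j != 0 -> F j = 0) -> zsum L F = F 0.
Proof.
move=> F0; have lt_L : (L < L.*2.+1)%N by lia.
rewrite /zsum (bigD1 (Ordinal lt_L)) //= subrr big1 ?addr0 // => i.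
by rewrite -val_eqE /= => ne_iL; apply: F0; lia.
Qed.

End SymmetricSums.

(** * Finite triple product and Schur's recurrence *)

Section FiniteIdentities.
Local Open Scope ring_scope.
Variables (R : comNzRingType) (q : R).

(* No truncation occurs: [j (5 j + 1)] is even and nonnegative for every integer [j]. *)
Definition pent (j : int) : nat := `|(j * (5 * j + 1))%R|./2.

Lemma pentE (j : int) : (pent j)%:Z * 2 = j * (5 * j + 1) :> int.
Proof.
rewrite /pent; have ge0 : 0 <= j * (5 * j + 1) by nia.
have : ~~ odd `|(j * (5 * j + 1))%R|.
  have [k [] ->] : exists k : int, j = k * 2 \/ j = k * 2 + 1.
    by exists (j %/ 2)%Z; lia.
  - have -> : k * 2 * (5 * (k * 2) + 1) = (k * (5 * (k * 2) + 1)) * 2 by ring.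
    by rewrite abszM oddM andbF.
  have -> : (k * 2 + 1) * (5 * (k * 2 + 1) + 1)
          = ((k * 2 + 1) * (5 * k + 3)) * 2 by ring.
  by rewrite abszM oddM andbF.
lia.
Qed.

Lemma pentS (j : int) : (pent (j + 1))%:Z = (pent j)%:Z + (5 * j + 3) :> int.
Proof.
have eq2 : (pent (j + 1))%:Z * 2 = ((pent j)%:Z + (5 * j + 3)) * 2 :> int.
  by rewrite mulrDl !pentE; ring.
lia.
Qed.

(** Common factor of the terms in both finite identities. Its sum over all [j] is the theta series
    of the product over exponents congruent to 0, 2 or 3 modulo 5. *)
Definition theta (j : int) : R := (-1) ^+ `|j| * q ^+ pent j.

Lemma theta0 : theta 0 = 1.
Proof. by rewrite /theta /pent mul0r !expr0 mul1r. Qed.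

(** The exponent grows by [5 j + 3] and the sign changes. That difference may be negative, so it is
    split between the natural exponents [a] and [b]. *)
Lemma thetaS (j : int) a b : (a%:Z + 5 * j + 3 = b%:Z :> int) ->
  theta (j + 1) * q ^+ a = - (theta j * q ^+ b).
Proof.
move=> def_b.
have eq_ab : (pent (j + 1) + a = pent j + b)%N.
  by have := pentS j; move: (pent _) (pent j); lia.
rewrite /theta -!mulrA -!exprD eq_ab -mulNr.
congr (_ * _).
have [j0|j0] := leP 0 j; first by rewrite -[RHS]mulN1r -exprS; congr (_ ^+ _); lia.
have -> : `|j|%N = `|(j + 1)%R|.+1 by lia.
by rewrite exprS mulN1r opprK.
Qed.

(* Both factors of the induction step come from one of the two Pascal rules,
   followed by a shift of the summation index. *)
Lemma finite_triple_product L a b : (a + b < L)%N ->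
  (\prod_(i < a) (1 - q ^+ (5 * i + 3))) * (\prod_(i < b) (1 - q ^+ (5 * i + 2)))
  = zsum L (fun j => theta j * gauss (q ^+ 5) (a + b) (b%:Z + j)).
Proof.
move=> ltL; elim: a ltL => [|a IHa] ltL; last first.
  rewrite big_ord_recr mulrAC IHa 1?ltnW // mulrBr mulr1 addSn.
  under [RHS]eq_zsum => j do rewrite gaussSr mulrDr.
  rewrite zsumD; congr (_ + _); rewrite -[RHS]zsum_shift; first last.
  - by rewrite gauss_gt ?mulr0 //; lia.
  - by rewrite gauss_lt0 ?mulr0 //; lia.
  rewrite mulrC -mulNr mulr_zsum; apply: eq_zsum => j.
  have -> : b%:Z + (j + 1) - 1 = b%:Z + j by lia.
  rewrite [LHS]mulrA [RHS]mulrA; apply: eq_mul_gauss => h1 h2.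
  have -> : ((a + b).+1%:Z - (b%:Z + (j + 1)) = a%:Z - j)%R by lia.
  rewrite -exprM (@thetaS _ _ (5 * a + 3)); first by rewrite mulNr mulrC.
  lia.
rewrite big_ord0 mul1r add0n; elim: b ltL => [|b IHb] ltL.
  rewrite big_ord0 zsum_eq0 /= ?theta0 ?mulr1 // => j j0.
  by rewrite add0r (negPf j0) mulr0.
rewrite big_ord_recr /= IHb 1?ltnW // mulrBr mulr1.
under [RHS]eq_zsum => j do rewrite mulrDr.
rewrite zsumD; congr (_ + _).
  by apply: eq_zsum => j; congr (_ * gauss _ _ _); lia.
rewrite mulrC -mulNr mulr_zsum -[LHS]zsum_shift; first last.
- by rewrite gauss_gt ?mulr0 ?oppr0 ?mulr0 //; lia.
- by rewrite gauss_lt0 ?mulr0 ?oppr0 ?mulr0 //; lia.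
apply: eq_zsum => j.
have -> : b%:Z + (j + 1) = b.+1%:Z + j by lia.
rewrite [LHS]mulrA [RHS]mulrA; apply: eq_mul_gauss => h1 h2.
rewrite mulNr mulrC -exprM (@thetaS _ _ (5 * `|(b.+1%:Z + j)%R|)) ?opprK //.
lia.
Qed.

Definition schur_sum L (n : nat) : R :=
  zsum L (fun j => theta j * gauss q n ((n%:Z - 5 * j) %/ 2)%Z).

Lemma schur_sum0 L : schur_sum L 0 = 1.
Proof.
rewrite /schur_sum zsum_eq0 /= ?theta0 ?mulr1 // => j j0.
have [/eqP|_] := eqVneq; last by rewrite mulr0.
by move: j0; lia.
Qed.

Lemma schur_sum1 L : schur_sum L 1 = 1.
Proof.
rewrite /schur_sum zsum_eq0 => [|j j0].
  by rewrite theta0 mul1r mulr0 subr0 gauss0.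
have [lt0|ge0] := ltP ((1%:Z - 5 * j) %/ 2)%Z 0; first by rewrite gauss_lt0 ?mulr0.
by rewrite gauss_gt ?mulr0 //; lia.
Qed.

(* Applying the Pascal rules twice, the [j]-th term of the difference of the two
   sides is [T j - T (j + 1)]; hence the difference telescopes. *)
Lemma schur_sumSS L m : (m < L)%N ->
  schur_sum L m.+2 = schur_sum L m.+1 + q ^+ m.+1 * schur_sum L m.
Proof.
move=> ltL.
pose h j : int := ((m.+2%:Z - 5 * j) %/ 2)%Z.
(* Successive [j] give [m + 2 - 5 j] opposite parities, so only one of the conditions in [T j] and
   [T (j + 1)] holds; the two cases below follow this parity. *)
pose T (j : int) : R := if ((m.+2%:Z - 5 * j) %% 2)%Z == 0
  then theta j * q ^+ `|h j| * gauss q m (h j) else 0.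
apply/eqP; rewrite -subr_eq0 opprD addrA; apply/eqP.
transitivity (T (- L%:Z) - T (L%:Z + 1)); last first.
  (* As [m < L], the index [h (- L)] exceeds [m] and [h (L + 1)] is negative. *)
  have -> : T (- L%:Z) = 0.
    by rewrite /T; case: ifP => // _; rewrite gauss_gt ?mulr0 // /h; lia.
  suff -> : T (L%:Z + 1) = 0 by rewrite subrr.
  by rewrite /T; case: ifP => // _; rewrite gauss_lt0 ?mulr0 // /h; lia.
rewrite -zsum_telescope /schur_sum mulr_zsum -!zsumB; apply: eq_zsum => j.
have [k [] k_eq] : exists k : int,
    m.+2%:Z - 5 * j = k * 2 \/ m.+2%:Z - 5 * j = k * 2 + 1.
  by exists ((m.+2%:Z - 5 * j) %/ 2)%Z; lia.
- have -> : ((m.+2%:Z - 5 * j) %/ 2)%Z = k by lia.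
  have -> : ((m.+1%:Z - 5 * j) %/ 2)%Z = k - 1 by lia.
  have -> : ((m%:Z - 5 * j) %/ 2)%Z = k - 1 by lia.
  have -> : T (j + 1) = 0 by rewrite /T ifF //; lia.
  have -> : T j = theta j * q ^+ `|k| * gauss q m k.
    by rewrite /T ifT; [congr (_ * _ ^+ _ * gauss _ _ _); rewrite /h|]; lia.
  have key : q ^+ `|k| * (q ^+ `|m.+1%:Z - k| * gauss q m (k - 1))
           = q ^+ m.+1 * gauss q m (k - 1).
    by rewrite mulrA -exprD; apply: eq_mul_gauss => h1 h2; congr (_ ^+ _); lia.
  rewrite gaussS [gauss q m.+1 k]gaussSr [q ^+ `|k| * _]mulrDr key; ring.
have -> : ((m.+2%:Z - 5 * j) %/ 2)%Z = k by lia.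
have -> : ((m.+1%:Z - 5 * j) %/ 2)%Z = k by lia.
have -> : ((m%:Z - 5 * j) %/ 2)%Z = k - 1 by lia.
have -> : T j = 0 by rewrite /T ifF //; lia.
have -> : T (j + 1) = theta (j + 1) * q ^+ `|(k - 2)%R| * gauss q m (k - 2).
  by rewrite /T ifT; [congr (_ * _ ^+ _ * gauss _ _ _); rewrite /h|]; lia.
rewrite gaussSr [gauss q m.+1 (k - 1)]gaussS.
have -> : k - 1 - 1 = k - 2 by lia.
have key : q ^+ `|m.+2%:Z - k| * (q ^+ `|(k - 1)%R| * gauss q m (k - 1))
         = q ^+ m.+1 * gauss q m (k - 1).
  by rewrite mulrA -exprD; apply: eq_mul_gauss => h1 h2; congr (_ ^+ _); lia.
rewrite (@eq_mul_gauss _ q m (k - 2) _ (- (theta j * q ^+ `|m.+2%:Z - k|))).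
  by rewrite [q ^+ `|m.+2%:Z - k| * _]mulrDr key; ring.
by move=> h1 h2; apply: thetaS; lia.
Qed.

End FiniteIdentities.

(** * Congruences modulo a power of X *)

Section Truncation.
Local Open Scope ring_scope.
Variable M : nat.

Definition eqX (f g : {poly int}) := exists h, f = g + 'X^M * h.

Lemma eqX_refl f : eqX f f.
Proof. by exists 0; rewrite mulr0 addr0. Qed.

Lemma eqX_sym f g : eqX f g -> eqX g f.
Proof. by case=> h ->; exists (- h); ring. Qed.

Lemma eqX_trans g f k : eqX f g -> eqX g k -> eqX f k.
Proof. by case=> h -> [h' ->]; exists (h + h'); ring. Qed.

Lemma eqXD f f' g g' : eqX f f' -> eqX g g' -> eqX (f + g) (f' + g').
Proof. by case=> h -> [h' ->]; exists (h + h'); ring. Qed.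

Lemma eqXM f f' g g' : eqX f f' -> eqX g g' -> eqX (f * g) (f' * g').
Proof. by case=> h -> [h' ->]; exists (h * g' + f' * h' + 'X^M * h * h'); ring. Qed.

Lemma eqX_coef f g i : eqX f g -> (i < M)%N -> f`_i = g`_i.
Proof. by case=> h -> iM; rewrite coefD coefXnM iM addr0. Qed.

Lemma eqX_Xn n : (M <= n)%N -> eqX 'X^n 0.
Proof. by move=> Mn; exists 'X^(n - M); rewrite add0r -exprD subnKC. Qed.

Lemma eqX_sum (I : finType) (F G : I -> {poly int}) :
  (forall i, eqX (F i) (G i)) -> eqX (\sum_i F i) (\sum_i G i).
Proof.
by move=> FG; elim/big_rec2: _ => [|i f g _]; [apply: eqX_refl | apply: eqXD].
Qed.

(** With [u = 1 - X w], the first [M] terms of the geometric series in [X w] form an inverse up to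
    [(X w)^M]. *)
Lemma eqX_inv (u : {poly int}) : u`_0 = 1 -> exists v, eqX (v * u) 1.
Proof.
move=> u0; have [w Dw] : exists w, u = 1 - 'X * w.
  exists (- drop_poly 1 u); rewrite mulrN opprK -[LHS](poly_take_drop 1) mulrC.
  congr (_ + _); apply/polyP=> i; rewrite coef_take_poly coef1.
  by case: i => [|i] //=; rewrite u0.
exists (\sum_(i < M) ('X * w) ^+ i), (- w ^+ M).
rewrite mulrC Dw -opprB mulNr -subrX1 exprMn; ring.
Qed.

(** Replaces division by a power series with constant term 1. *)
Lemma eqX_mulI (u f g : {poly int}) : u`_0 = 1 -> eqX (u * f) (u * g) -> eqX f g.
Proof.
move=> /eqX_inv[v vu] ufg.
have cancel_u h : eqX (v * (u * h)) h.
  by rewrite mulrA -[X in eqX _ X]mul1r; apply: eqXM => //; apply: eqX_refl.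
apply: eqX_trans (eqX_sym (cancel_u f)) _; apply: eqX_trans (cancel_u g).
by apply: eqXM => //; apply: eqX_refl.
Qed.

(** Factors with exponent at least [M] are 1 modulo [X^M], so every long enough product represents
    the infinite one. *)
Lemma eqX_qfact e m n : (0 < e)%N -> (M <= m)%N -> (M <= n)%N ->
  eqX (qfact 'X^e m) (qfact 'X^e n).
Proof.
move=> e0 Mm Mn; suff {m n Mm Mn} base n : (M <= n)%N -> eqX (qfact 'X^e n) (qfact 'X^e M).
  by apply: eqX_trans (base _ _) (eqX_sym (base _ _)).
elim: n => [|n IH]; first by rewrite leqn0 => /eqP->; apply: eqX_refl.
rewrite leq_eqVlt => /predU1P[->|Mn]; first exact: eqX_refl.
rewrite qfactS -[X in eqX _ X]mulr1; apply: eqXM; first exact: IH.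
rewrite -[X in eqX _ X]subr0 -exprM; apply: eqXD; first exact: eqX_refl.
have [h ->] : eqX 'X^(e * n.+1) 0 by apply: eqX_Xn; nia.
by exists (- h); ring.
Qed.

Lemma coef0_1subXn n : (1 - 'X^(n.+1) : {poly int})`_0 = 1.
Proof. by rewrite coefB coef1 coefXn subr0. Qed.

Lemma coef0_prod1 (I : finType) (F : I -> {poly int}) :
  (forall i, (F i)`_0 = 1) -> (\prod_i F i)`_0 = 1.
Proof. by move=> F1; rewrite coef0_prod big1. Qed.

Lemma coef0_qfact e n : (0 < e)%N -> (qfact 'X^e n : {poly int})`_0 = 1.
Proof.
move=> e0; apply: coef0_prod1 => i; rewrite -exprM.
by case: (_ * _)%N (muln_gt0 e i.+1) => [|k _]; [rewrite e0 | apply: coef0_1subXn].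
Qed.

(** The limit [1 / (q; q)_oo] of Gaussian binomials: once [k] and [n - k] are at least [M], all
    three products in [qfact_gauss] agree modulo [X^M]. *)
Lemma eqX_gauss e n k : (0 < e)%N -> (M <= k)%N -> (M + k <= n)%N ->
  eqX (qfact 'X^e n * gauss 'X^e n k%:Z) 1.
Proof.
move=> e0 Mk kn; have := @qfact_gauss _ ('X^e : {poly int}) k (n - k).
rewrite subnKC 1?(leq_trans (leq_addl M k)) // => def_qn.
have qM : eqX (qfact 'X^e k * qfact 'X^e (n - k)) (qfact 'X^e n * qfact 'X^e n).
  by apply: eqXM; apply: eqX_qfact => //; lia.
apply: (@eqX_mulI (qfact 'X^e n)); first exact: coef0_qfact.
rewrite mulr1 mulrA -[X in eqX _ X]def_qn; apply: eqXM; last exact: eqX_refl.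
exact: eqX_sym.
Qed.

End Truncation.

(** * The Rogers-Ramanujan identity modulo [X^M] *)

Section RogersRamanujanSeries.
Local Open Scope ring_scope.
Variable M : nat.

Lemma eqX_theta (j : int) : (M <= `|j|)%N -> eqX M (theta 'X j) 0.
Proof.
move=> Mj; rewrite /theta -[X in eqX _ _ X](mulr0 ((-1) ^+ `|j|)).
apply: eqXM; first exact: eqX_refl.
by apply: eqX_Xn; have := pentE j; nia.
Qed.

(** For [|j| >= M] both sides vanish modulo [X^M], whatever [k] is; for smaller [|j|] the limit of
    the Gaussian binomial applies. *)
Lemma eqX_theta_gauss e m n (j k : int) : (0 < e)%N -> (M <= m)%N -> (M <= n)%N ->
  ((`|j| < M)%N -> M%:Z <= k /\ M%:Z + k <= n%:Z) ->
  eqX M (qfact 'X^e m * (theta 'X j * gauss 'X^e n k)) (theta 'X j).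
Proof.
move=> e0 Mm Mn jk; rewrite mulrCA; have [Mj|jM] := leqP M `|j|.
  apply: eqX_trans (eqX_sym (eqX_theta Mj)).
  rewrite -[X in eqX _ _ X](mul0r (qfact 'X^e m * gauss 'X^e n k)).
  by apply: eqXM; [apply: eqX_theta | apply: eqX_refl].
rewrite -[X in eqX _ _ X]mulr1; apply: eqXM; first exact: eqX_refl.
have [Mk kn] := jk jM; have -> : k = `|k|%N%:Z by lia.
apply: (@eqX_trans _ (qfact 'X^e n * gauss 'X^e n `|k|%N)).
  by apply: eqXM; [apply: eqX_qfact | apply: eqX_refl].
by apply: eqX_gauss => //; lia.
Qed.

Lemma qfact_mod5 (R : comNzRingType) (x : R) n :
  qfact x (5 * n) = qfact (x ^+ 5) n
    * (\prod_(i < n) (1 - x ^+ (5 * i + 3)) * \prod_(i < n) (1 - x ^+ (5 * i + 2)))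
    * \prod_(i < n) ((1 - x ^+ (5 * i + 1)) * (1 - x ^+ (5 * i + 4))).
Proof.
elim: n => [|n IH]; first by rewrite muln0 /qfact !big_ord0 !mulr1.
have def5 : (5 * n.+1)%N = (5 * n).+4.+1 by lia.
rewrite [in LHS]def5 !qfactS IH !big_ord_recr /= -exprM def5.
rewrite addn1 addn2 addn3 addn4; ring.
Qed.

(** The Schur sum and the product over residues 2 and 3, multiplied by [qfact] in base [X] and [X^5]
    respectively, have the same theta limit. Sorting the factors of [qfact 'X] by residue modulo 5
    then lets everything but residues 1 and 4 cancel. *)
Theorem rogers_ramanujan_series :
  eqX M ((\prod_(i < 2 * M) ((1 - 'X^(5 * i + 1)) * (1 - 'X^(5 * i + 4))))
         * schur_sum 'X (7 * M).+1 (7 * M)) 1.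
Proof.
set V := \prod_(i < 2 * M) _; set E := schur_sum _ _ _.
pose W : {poly int} :=
  \prod_(i < 2 * M) (1 - 'X^(5 * i + 3)) * \prod_(i < 2 * M) (1 - 'X^(5 * i + 2)).
pose Theta := zsum (7 * M).+1 (theta ('X : {poly int})).
(* For [|j| < M] the index [(7 M - 5 j) / 2] stays at distance at least [M] from [0] and [7 M], and
   below so does [2 M + j] from [0] and [4 M]. *)
have uE : eqX M (qfact 'X (5 * (2 * M)) * E) Theta.
  rewrite /E /schur_sum mulr_zsum; apply: eqX_sum => i.
  by apply: (@eqX_theta_gauss 1) => //; lia.
have uW : eqX M (qfact 'X^5 (2 * M) * W) Theta.
  rewrite /W (@finite_triple_product _ _ (7 * M).+1); last by lia.
  by rewrite mulr_zsum; apply: eqX_sum => i; apply: eqX_theta_gauss => //; lia.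
apply: (@eqX_mulI _ (qfact 'X^5 (2 * M) * W)).
  rewrite coef0M coef0_qfact // mul1r coef0M !coef0_prod1 // => i.
  - by rewrite addn2; apply: coef0_1subXn.
  - by rewrite addn3; apply: coef0_1subXn.
rewrite mulr1 mulrA -qfact_mod5.
exact: eqX_trans uE (eqX_sym uW).
Qed.

End RogersRamanujanSeries.

(** * Enumeration of integer partitions *)

Section Enumeration.

Definition mod5_part (m : nat) := (m %% 5 == 1) || (m %% 5 == 4).

(** Nonincreasing lists with parts below [n], each repeated fewer than [c] times; the bound [c]
    keeps the enumeration finite. *)
Fixpoint mod5_lists (c n : nat) : seq (seq nat) :=
  if n is m.+1 then
    if mod5_part m then [seq nseq k m ++ s | k <- iota 0 c, s <- mod5_lists c m]
    else mod5_lists c m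
  else [:: [::]].

(** For bound [n + 2], either all parts are below [n + 1], or the largest is [n + 1] and the others
    are below [n]. This is the recurrence of [E]. *)
Fixpoint gap_lists (n : nat) : seq (seq nat) :=
  if n is m.+1 then
    if m is p.+1 then gap_lists m ++ [seq m :: s | s <- gap_lists p] else [:: [::]]
  else [:: [::]].

Definition gap : rel nat := fun a b => b.+1 < a.

Lemma gap_trans : transitive gap.
Proof. by rewrite /gap => a b c; lia. Qed.

Lemma geq_trans : transitive geq.
Proof. by move=> a b c /=; lia. Qed.

Lemma geq_total : total geq.
Proof. by move=> a b /=; lia. Qed.

Lemma geq_anti : antisymmetric geq.
Proof. by move=> a b /=; lia. Qed.

Lemma mod5_part_gt0 m : mod5_part m -> 0 < m.
Proof. by case: m. Qed.

(** Undoes one step of the recursion of [mod5_lists]. *)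
Lemma sorted_geq_split m s : sorted geq s -> all (fun x => x < m.+1) s ->
  s = nseq (count_mem m s) m ++ [seq x <- s | x != m].
Proof.
elim: s => [|x s IH] //= x_s /andP[xm sm].
have {IH} IH := IH (path_sorted x_s) sm.
have [def_x|xNm] := eqVneq x m; first by rewrite def_x /= -IH.
have m_s : m \notin s.
  apply/negP=> m_s; have /allP/(_ _ m_s) /= := order_path_min geq_trans x_s.
  by move: xm xNm; lia.
rewrite (count_memPn m_s) /=; congr (_ :: _).
by rewrite [LHS]IH (count_memPn m_s).
Qed.

Lemma mem_mod5_lists c n s : s \in mod5_lists c n ->
  [/\ sorted geq s, all mod5_part s & all (fun x => x < n) s].
Proof.
elim: n s => [|m IH] s /=; first by rewrite inE => /eqP->.
case: ifP => m5; last first.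
  by case/IH => -> -> /allP sm; split=> //; apply/allP=> x /sm /ltnW.
case/allpairsP=> -[k t] /= [_ /IH[sort_t t5 tm] ->]; split.
- rewrite sorted_pairwise; last exact: geq_trans.
  rewrite pairwise_cat -!sorted_pairwise; do ?exact: geq_trans.
  rewrite sort_t andbT; apply/andP; split.
    apply/allrelP => x y; rewrite mem_nseq => /andP[_ /eqP->].
    by move/allP: tm => tm /tm /ltnW.
  by elim: k => [|[|k] IHk] //=; rewrite leqnn.
- by rewrite all_cat t5 all_nseq m5 orbT.
rewrite all_cat all_nseq ltnSn orbT /=.
by apply/allP=> x; move/allP: tm => tm /tm /ltnW.
Qed.

(** The size of the list bounds all multiplicities at once. *)
Lemma mod5_lists_mem c n s : sorted geq s -> all mod5_part s ->
  all (fun x => x < n) s -> size s < c -> s \in mod5_lists c n.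
Proof.
elim: n s => [|m IH] s sort_s s5 sm size_s; first by case: s sm {sort_s s5 size_s}.
have def_s := sorted_geq_split sort_s sm.
set t := filter _ s in def_s.
have t_m : all (fun x => x < m) t.
  apply/allP=> x; rewrite mem_filter => /andP[xm /(allP sm)] /=.
  by move: xm; lia.
have t_mem : t \in mod5_lists c m.
  apply: IH => //.
  - exact: sorted_filter geq_trans _ _ sort_s.
  - by apply/allP=> x; rewrite mem_filter => /andP[_ /(allP s5)].
  - by rewrite size_filter (leq_ltn_trans _ size_s) ?count_size.
rewrite /=; case: ifP => m5.
  apply/allpairsP; exists (count_mem m s, t); split=> //=.
  by rewrite mem_iota (leq_ltn_trans _ size_s) ?count_size.
suff -> : s = t by [].
rewrite [LHS]def_s (count_memPn _) //.
by apply/negP=> /(allP s5); rewrite m5.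
Qed.

(** The tails have parts below [m], so the number of copies of [m] recovers [k]. *)
Lemma mod5_lists_uniq c n : uniq (mod5_lists c n).
Proof.
elim: n => [|m IH] //=; case: ifP => // _.
apply: allpairs_uniq => //; first exact: iota_uniq.
move=> [k s] [l t] /allpairsP[[k' s'] /= [_ /mem_mod5_lists[_ _ sm] [-> ->]]].
move=> /allpairsP[[l' t'] /= [_ /mem_mod5_lists[_ _ tm] [-> ->]]] eq_st.
have no_m (v : seq nat) : all (fun x => x < m) v -> count_mem m v = 0.
  by move=> vm; apply/count_memPn/negP=> /(allP vm); rewrite ltnn.
have eq_kl : k' = l'.
  have := congr1 (count_mem m) eq_st.
  by rewrite !count_cat !count_nseq /= eqxx !mul1n !no_m // !addn0.
move: eq_st; rewrite eq_kl => /eqP; rewrite eqseq_cat // eqxx /= => /eqP->.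
by [].
Qed.

Lemma mem_gap_lists n s :
  (s \in gap_lists n) = sorted gap s && all (fun x => 0 < x < n) s.
Proof.
have [m] := ubnP n; elim: m n s => // m IH [|[|n]] s lt_nm.
- by rewrite /= inE; case: s => [|x s] //=; rewrite ltn0 !andbF.
- by rewrite /= inE; case: s => [|x s] //=; case: x => [|x]; rewrite ?andbF.
rewrite -[gap_lists n.+2]/(gap_lists n.+1 ++ [seq n.+1 :: s | s <- gap_lists n]).
rewrite mem_cat IH //.
apply/orP/andP => [[/andP[-> sn]|/mapP[t]]|[sort_s sn]].
- by split=> //; apply: sub_all sn => x /=; lia.
- rewrite IH; last by lia.
  case/andP=> sort_t tn ->; split=> /=; last first.
    by rewrite ltnSn; apply: sub_all tn => x /=; lia.
  rewrite path_sortedE ?sort_t ?andbT; last exact: gap_trans.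
  by apply: sub_all tn => x; rewrite /gap; lia.
case: s sort_s sn => [|x s] /=; first by left.
rewrite path_sortedE; last exact: gap_trans.
move=> /andP[xs sort_s] /andP[/andP[x0 xn] sn].
have s_lt : all (fun y => 0 < y < x.-1) s.
  by apply/allP=> y y_s; have := allP xs y y_s; have := allP sn y y_s; rewrite /gap; lia.
have [def_x|lt_xn] := eqVneq x n.+1.
  right; rewrite def_x; apply/mapP; exists s => //; rewrite IH; last by lia.
  by rewrite sort_s /=; apply: sub_all s_lt => y; lia.
left; rewrite xs sort_s x0 /=; apply/andP; split; first by lia.
by apply: sub_all s_lt => y; lia.
Qed.

Lemma gap_lists_uniq n : uniq (gap_lists n).
Proof.
have [m] := ubnP n; elim: m n => // m IH [|[|n]] lt_nm //.
rewrite -[gap_lists n.+2]/(gap_lists n.+1 ++ [seq n.+1 :: s | s <- gap_lists n]).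
rewrite cat_uniq !IH ?map_inj_uniq ?IH //; try by lia.
  rewrite andbT; apply/hasPn => _ /mapP[s _ ->].
  by rewrite -[X in ~~ X]/(_ \in gap_lists n.+1) mem_gap_lists /= ltnn andbF.
by move=> s t [].
Qed.

(** * Generating polynomials of the two enumerations *)

Section GeneratingFunction.
Local Open Scope ring_scope.

Definition genfun (l : seq (seq nat)) : {poly int} := \sum_(s <- l) 'X^(sumn s).

Lemma coef_genfun l w : (genfun l)`_w = (count (fun s => sumn s == w) l)%:R.
Proof.
rewrite /genfun coef_sum; elim: l => [|s l IH]; first by rewrite big_nil.
by rewrite big_cons IH coefXn /= natrD eq_sym.
Qed.

(** Both sides have the same recurrence and initial values: prepending the part [n + 1] multiplies
    by [X^(n+1)]. *)
Lemma genfun_gap_lists L n : (n <= L)%N -> genfun (gap_lists n) = schur_sum 'X L n.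
Proof.
have [m] := ubnP n; elim: m n => // m IH [|[|n]] lt_nm nL.
- by rewrite schur_sum0 /genfun /= big_seq1.
- by rewrite schur_sum1 /genfun /= big_seq1.
rewrite schur_sumSS; last by lia.
rewrite -[gap_lists n.+2]/(gap_lists n.+1 ++ [seq n.+1 :: s | s <- gap_lists n]).
rewrite /genfun big_cat big_map -!IH; try by lia.
rewrite /genfun /= mulr_sumr; congr (_ + _).
by apply: eq_bigr => s _; rewrite -exprD.
Qed.

(** The copies of a part [n] contribute a geometric sum of [c] terms. Times [1 - X^n] it is
    [1 - X^(n c)], and [n c >= M] because [n] is positive. *)
Lemma genfun_mod5_lists M c n : (M <= c)%N ->
  eqX M (\prod_(i < n | mod5_part i) (1 - 'X^i) * genfun (mod5_lists c n)) 1.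
Proof.
move=> Mc; elim: n => [|n IH].
  by rewrite big_ord0 /genfun /= big_seq1 mul1r; apply: eqX_refl.
rewrite big_mkcond big_ord_recr -big_mkcond /=; case: ifP => n5; last by rewrite mulr1.
have -> : genfun [seq nseq k n ++ s | k <- iota 0 c, s <- mod5_lists c n]
        = (\sum_(k < c) 'X^n ^+ k) * genfun (mod5_lists c n).
  rewrite /genfun big_allpairs_dep mulr_suml -(big_mkord xpredT (fun k => 'X^n ^+ k * _)).
  rewrite /index_iota subn0; apply: eq_bigr => k _; rewrite mulr_sumr.
  by apply: eq_bigr => s _; rewrite sumn_cat sumn_nseq exprD exprM.
have -> : (\prod_(i < n | mod5_part i) (1 - 'X^i)) * (1 - 'X^n)
    * ((\sum_(k < c) 'X^n ^+ k) * genfun (mod5_lists c n))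
  = (1 - 'X^(n * c)) * (\prod_(i < n | mod5_part i) (1 - 'X^i) * genfun (mod5_lists c n)).
  have -> : 1 - 'X^(n * c) = (1 - 'X^n) * \sum_(k < c) 'X^n ^+ k :> {poly int}.
    by rewrite exprM -opprB subrX1 -mulNr opprB.
  ring.
rewrite -[X in eqX _ _ X]mul1r; apply: eqXM => //.
rewrite -[X in eqX _ _ X]subr0; apply: eqXD; first exact: eqX_refl.
have [h ->] : eqX M 'X^(n * c) 0.
  by apply: eqX_Xn; have := mod5_part_gt0 n5; nia.
by exists (- h); ring.
Qed.

Lemma prod_mod5_part (R : comNzRingType) (x : R) n :
  \prod_(i < 5 * n | mod5_part i) (1 - x ^+ i)
  = \prod_(i < n) ((1 - x ^+ (5 * i + 1)) * (1 - x ^+ (5 * i + 4))).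
Proof.
elim: n => [|n IH]; first by rewrite muln0 !big_ord0.
rewrite big_ord_recr -IH big_mkcond [in RHS]big_mkcond /=.
have -> : (5 * n.+1)%N = (5 * n).+4.+1 by lia.
have [m0 m1 m2 m3 m4] : [/\ mod5_part (5 * n) = false, mod5_part (5 * n).+1,
    mod5_part (5 * n).+2 = false, mod5_part (5 * n).+3 = false
    & mod5_part (5 * n).+4] by rewrite /mod5_part; split; lia.
rewrite !big_ord_recr /= m0 m1 m2 m3 m4 !mulr1 addn1 addn4 mulrA.
by [].
Qed.

(** Both sides are inverse to the same product modulo [X^M]. *)
Theorem genfun_mod5_gap M :
  eqX M (genfun (mod5_lists M (5 * (2 * M)))) (genfun (gap_lists (7 * M))).
Proof.
have := @genfun_mod5_lists M M (5 * (2 * M)) (leqnn M); rewrite prod_mod5_part => mod5_1.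
have gap_1 := rogers_ramanujan_series M.
rewrite -(@genfun_gap_lists (7 * M).+1) // in gap_1.
apply: eqX_mulI (eqX_trans mod5_1 (eqX_sym gap_1)).
apply: coef0_prod1 => i.
by rewrite coef0M addn1 addn4 !coef0_1subXn mulr1.
Qed.

End GeneratingFunction.

End Enumeration.

(** * The bijection for integer partitions *)

Section IntegerPartitions.

Definition mod5_partition (s : seq nat) := all mod5_part s.

(** Stated by membership, hence independent of order: for distinct integers, gaps of at least 2 mean
    that no two are consecutive. *)
Definition gap_partition (s : seq nat) :=
  [&& 0 \notin s, uniq s & all (fun x => x.+1 \notin s) s].

Definition perm_invariant (P : pred (seq nat)) := forall s t, perm_eq s t -> P s = P t.

Lemma perm_mod5 : perm_invariant mod5_partition.
Proof. by move=> s t; apply: perm_all. Qed.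

Lemma perm_gap : perm_invariant gap_partition.
Proof.
move=> s t st; rewrite /gap_partition (perm_mem st) (perm_uniq st) (perm_all _ st).
by congr [&& _, _ & _]; apply: eq_all => x; rewrite (perm_mem st).
Qed.

Lemma sorted_gapE s :
  sorted gap s && all (leq 1) s = sorted geq s && gap_partition s.
Proof.
rewrite /gap_partition; elim: s => [|x s IH] //=.
rewrite !path_sortedE; [|exact: geq_trans|exact: gap_trans].
rewrite inE negb_or andbACA IH (eq_sym 0) -lt0n; apply/idP/idP.
- case/andP=> /andP[xs x0] /and4P[sort_s s0 us sS].
  have s_lt y : y \in s -> y.+1 < x by move/(allP xs).
  rewrite sort_s x0 s0 us /= !andbT; apply/and4P; split.
  + by apply/allP=> y /s_lt /=; lia.
  + by apply/negP=> /s_lt; lia.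
  + by rewrite inE negb_or; apply/andP; split; [lia | apply/negP=> /s_lt; lia].
  apply/allP=> y y_s; rewrite inE negb_or (allP sS y y_s) andbT.
  by have := s_lt y y_s; lia.
case/andP=> /andP[xs sort_s] /and3P[/andP[x0 s0] /andP[x_s us] /andP[_ sS]].
rewrite sort_s x0 s0 us /= andbT; apply/andP; split.
  apply/allP=> y y_s; have := allP sS y y_s; rewrite inE negb_or /gap => /andP[yx _].
  have : y != x by apply: contraNneq x_s => <-.
  by have := allP xs y y_s; rewrite /=; move: yx; lia.
by apply: sub_all sS => y; rewrite inE negb_or => /andP[].
Qed.

(* Integer partitions are lists up to permutation, so [g] inverts [f] only up to
   [perm_eq] and the last clause makes [f] well defined on them. *)
Definition weight_map (P Q : pred (seq nat)) (f g : seq nat -> seq nat) :=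
  forall s, P s -> [/\ Q (f s), sumn (f s) = sumn s, perm_eq (g (f s)) s
                     & forall t, perm_eq s t -> f s = f t].

(** Matches two enumerations of the same weight by position. The default [[::]] is not reached when
    they are equally long and the first contains the sorted [s]. *)
Definition transfer (LP LQ : nat -> seq (seq nat)) (s : seq nat) : seq nat :=
  nth [::] (LQ (sumn s)) (index (sort geq s) (LP (sumn s))).

Definition enumerates (L : nat -> seq (seq nat)) (P : pred (seq nat)) :=
  forall w s, (s \in L w) = [&& sorted geq s, P s & sumn s == w].

(** Uniqueness makes positions invertible, and sorting picks one representative in each permutation
    class. *)
Lemma transfer_weight_map P Q LP LQ : perm_invariant P ->
    enumerates LP P -> enumerates LQ Q ->
    (forall w, uniq (LP w)) -> (forall w, uniq (LQ w)) ->
    (forall w, size (LP w) = size (LQ w)) ->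
  weight_map P Q (transfer LP LQ) (transfer LQ LP).
Proof.
move=> permP memP memQ uniqP uniqQ eq_size s Ps.
have perm_s : perm_eq (sort geq s) s by rewrite perm_sort.
have s_LP : sort geq s \in LP (sumn s).
  by rewrite memP (sort_sorted geq_total) (permP _ _ perm_s) Ps (perm_sumn perm_s) /=.
have lt_i : index (sort geq s) (LP (sumn s)) < size (LQ (sumn s)).
  by rewrite -eq_size index_mem.
have /[dup] fs_LQ : transfer LP LQ s \in LQ (sumn s) by apply: mem_nth.
rewrite memQ => /and3P[sort_fs Qfs /eqP sum_fs]; split=> //.
  rewrite {1}/transfer sum_fs (sorted_sort geq_trans sort_fs) /transfer index_uniq //.
  by rewrite nth_index.
move=> t st; rewrite /transfer (perm_sumn st); congr (nth _ _ (index _ _)).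
by apply/(perm_sortP geq_total geq_trans geq_anti).
Qed.

Theorem rogers_ramanujan_bijection : exists f g,
  weight_map mod5_partition gap_partition f g
  /\ weight_map gap_partition mod5_partition g f.
Proof.
pose of_weight w l := [seq s : seq nat <- l | sumn s == w].
(* A partition of [w] has at most [w] parts, each at most [w], so these bounds lose nothing. They
   are the bounds of the congruence modulo [X^(w+1)], which determines the coefficient of [X^w]. *)
pose LP w := of_weight w (mod5_lists w.+1 (5 * (2 * w.+1))).
pose LQ w := of_weight w (gap_lists (7 * w.+1)).
have leq_sumn s : {in s, forall x, x <= sumn s}.
  move=> x; elim: s => //= y s IH; rewrite inE => /predU1P[<-|/IH]; lia.
have memP : enumerates LP mod5_partition.
  move=> w s; rewrite mem_filter andbC [RHS]andbA; apply: andb_id2r => /eqP sum_s.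
  apply/idP/andP => [/mem_mod5_lists[] // | [sort_s s5]].
  apply: mod5_lists_mem => //.
    by apply/allP=> x /leq_sumn; rewrite sum_s; lia.
  rewrite -sum_s ltnS; elim: s s5 {sum_s sort_s} => //= x s IH /andP[/mod5_part_gt0 x0 /IH].
  lia.
have memQ : enumerates LQ gap_partition.
  move=> w s; rewrite mem_filter andbC [RHS]andbA; apply: andb_id2r => /eqP sum_s.
  rewrite mem_gap_lists -sorted_gapE; congr (_ && _); apply: eq_in_all => x.
  by move/leq_sumn; rewrite sum_s; lia.
have uniqP w : uniq (LP w) by rewrite filter_uniq ?mod5_lists_uniq.
have uniqQ w : uniq (LQ w) by rewrite filter_uniq ?gap_lists_uniq.
have eq_size w : size (LP w) = size (LQ w).
  have := eqX_coef (genfun_mod5_gap w.+1) (ltnSn w).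
  by rewrite !coef_genfun !size_filter => /eqP; rewrite eqr_nat => /eqP.
exists (transfer LP LQ), (transfer LQ LP); split; apply: transfer_weight_map => //.
- exact: perm_mod5.
- exact: perm_gap.
Qed.

End IntegerPartitions.

(** * Scale and primitive factor *)

Section NumberField.
Local Open Scope classical_set_scope.
Local Open Scope ring_scope.

(** [g] is constant on the fibres of [f], so composing it with any choice of preimages gives a
    morphism. *)
Lemma rmorphism_factor (A : nzRingType) (F C : fieldType)
    (f : {rmorphism A -> F}) (g : {rmorphism A -> C}) :
  (forall y, exists a, f a = y) -> (forall a, f a = 0 -> g a = 0) ->
  inhabited {rmorphism F -> C}.
Proof.
move=> f_surj ker_fg.
have {f_surj} [r fr] := choice f_surj.
have eq_g a b : f a = f b -> g a = g b.
  move=> ab; apply/eqP; rewrite -subr_eq0 -rmorphB ker_fg //.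
  by rewrite rmorphB ab subrr.
have gB : zmod_morphism (g \o r).
  by move=> x y /=; rewrite -rmorphB; apply: eq_g; rewrite rmorphB !fr.
have gM : monoid_morphism (g \o r).
  split=> [|x y] /=; first by rewrite -(rmorph1 g); apply: eq_g; rewrite fr rmorph1.
  by rewrite -rmorphM; apply: eq_g; rewrite rmorphM !fr.
pose gaM := GRing.isZmodMorphism.Build F C (g \o r) gB.
pose gmM := GRing.isMonoidMorphism.Build F C (g \o r) gM.
by exists; exact: (HB.pack (g \o r) gaM gmM : {rmorphism F -> C}).
Qed.

Variable K : fieldExtType rat.

(** By the primitive element theorem [K] is a quotient of [Q[X]] by a minimal polynomial; sending
    [X] to a root in [algC] gives an embedding. Total positivity is thereby not vacuous. *)
Lemma embedding_exists : inhabited {rmorphism K -> algC}.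
Proof.
have sepK : separable 1 {:K}.
  apply/separableP=> u _; apply: pcharf0_separable.
  exact: ftrans (pchar_lalg K) (pchar_num _).
pose z := separable_generator 1 {:K}.
have Kz : {:K}%VS = <<1; z>>%VS by apply: eq_adjoin_separable_generator (subvf _).
have /polyOver1P[p def_p] := minPolyOver 1 z.
have size_p : size p != 1%N.
  by rewrite -(size_map_poly (in_alg K)) -def_p size_minPoly.
have [w pw] : exists w : algC, root (map_poly ratr p) w.
  by apply/closed_rootP; rewrite size_map_poly.
pose hC : {rmorphism {poly rat} -> algC} := horner_eval w \o map_poly ratr.
apply: (@rmorphism_factor _ _ _ (fieldExt_horner z) hC) => [y|q].
  have : y \in <<1; z>>%VS by rewrite -Kz memvf.
  move=> /Fadjoin_poly_eq def_y.
  have /polyOver1P[q def_q] := Fadjoin_polyOver 1 z y.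
  by exists q; rewrite -def_y def_q.
move=> qz; have /dvdpP[r ->] : p %| q.
  rewrite -(dvdp_map (in_alg K)) -def_p; apply: minPoly_dvdp; last exact/rootP.
  by apply/polyOver1P; exists q.
by rewrite rmorphM /= {2}/horner_eval (rootP pw) mulr0.
Qed.

Notation integral := (integralOver (intr : int -> K)).

Lemma totally_positive_neq0 (x : K) : totally_positive x -> x != 0.
Proof.
have [sigma] := embedding_exists.
by move=> /(_ sigma) sx; apply: contraTneq sx => ->; rewrite rmorph0 ltxx.
Qed.

(** The constant coefficient of a monic integral equation for [x] is a multiple of [x]; if it is 0,
    the equation can be divided by [X] as [x != 0]. Like a norm, it will bound the natural numbers
    dividing [x]. *)
Lemma integral_nonzero_multiple (x : K) : integral x -> x != 0 ->
  exists2 c : int, c != 0 & exists2 w, integral w & c%:~R = x * w.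
Proof.
case=> p mon_p; have [n] := ubnP (size p).
elim: n p mon_p => // n IH p mon_p size_p px x0.
have def_p : p = (p`_0)%:P + 'X * drop_poly 1 p.
  rewrite -[LHS](poly_take_drop 1) [X in _ + X = _]mulrC; congr (_ + _).
  by apply/polyP=> i; rewrite coef_take_poly coefC; case: i.
have eval_p : (p`_0)%:~R + x * (map_poly intr (drop_poly 1 p)).[x] = 0 :> K.
  move/rootP: px; rewrite {1}def_p rmorphD rmorphM /= map_polyC map_polyX.
  by rewrite hornerD hornerC hornerM hornerX.
have [p0|p0] := eqVneq p`_0 0.
  apply: (IH (drop_poly 1 p)) => //.
  - rewrite monicE lead_coefE size_drop_poly coef_drop_poly.
    move: mon_p px; rewrite monicE lead_coefE; case: (size p) => [|[|k]] //=.
      by rewrite p0.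
      by rewrite p0.
    by rewrite addn1.
  - rewrite size_drop_poly; move: size_p (monic_neq0 mon_p).
    by rewrite -size_poly_gt0; lia.
  by move/eqP: eval_p; rewrite p0 add0r mulf_eq0 (negPf x0).
exists p`_0 => //; exists (- (map_poly intr (drop_poly 1 p)).[x]).
  apply: integral_opp; apply: integral_horner; last by exists p.
  by apply/integral_poly=> i; rewrite coef_map; apply: integral_id.
by rewrite mulrN; apply/eqP; rewrite -addr_eq0 eval_p.
Qed.

(** [v = c / n] is a rational algebraic integer, hence an integer, so [n] divides [c]. An embedding
    moves the argument to [algC]. *)
Lemma integral_divisor_le (c : int) n (v : K) : c != 0 ->
  integral v -> c%:~R = n%:R * v -> (n <= `|c|)%N.
Proof.
move=> c0 int_v def_c; have [sigma] := embedding_exists.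
have def_sc : c%:~R = n%:R * sigma v by rewrite -(rmorph_int sigma) def_c rmorphM rmorph_nat.
have n0 : n%:R != 0 :> algC.
  by apply: contraNneq c0 => n0; move/eqP: def_sc; rewrite n0 mul0r intr_eq0.
have Av : sigma v \in Aint.
  have [p mon_p pv] := int_v.
  apply: (@root_monic_Aint (map_poly intr p)).
  - rewrite (eq_map_poly (g := sigma \o intr)) => [|i]; last by rewrite /= rmorph_int.
    by rewrite map_poly_comp fmorph_root.
  - exact: monic_map.
  - by apply/polyOverP=> i; rewrite coef_map /= intr_int.
have Qv : sigma v \in Crat.
  have -> : sigma v = c%:~R / n%:R by rewrite def_sc mulrAC mulfV ?mul1r.
  by rewrite rpred_div ?rpred_int ?rpred_nat.
have /intrP[m def_v] := Cint_rat_Aint Qv Av.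
have {def_sc} def_c' : c = n%:Z * m.
  by apply/eqP; rewrite -(eqr_int algC) rmorphM /= def_sc def_v.
rewrite def_c' abszM leq_pmulr // absz_gt0.
by apply: contraNneq c0 => m0; rewrite def_c' m0 mulr0.
Qed.

Lemma totally_positiveM_nat n (x : K) :
  (0 < n)%N -> totally_positive (n%:R * x) <-> totally_positive x.
Proof.
move=> n0; split=> x_gt0 sigma; have := x_gt0 sigma;
  by rewrite rmorphM rmorph_nat pmulr_rgt0 ?ltr0n.
Qed.

Lemma Oplus_muln n (x : K) : (0 < n)%N -> Oplus x -> Oplus (n%:R * x).
Proof.
move=> n0 [int_x x0]; split; last exact/totally_positiveM_nat.
by apply: integral_mul => //; apply: integral_nat.
Qed.

Lemma natr_neq0 n : (0 < n)%N -> n%:R != 0 :> K.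
Proof.
by move=> n0; have /pcharf0P -> := ftrans (pchar_lalg K) (pchar_num rat); rewrite -lt0n.
Qed.

Lemma scale_primitive_exists (x : K) : Oplus x ->
  exists s t, [/\ (0 < s)%N, primitive t & x = s%:R * t].
Proof.
move=> Ox; have [int_x x_gt0] := Ox.
have [c c0 [w int_w def_c]] := integral_nonzero_multiple int_x (totally_positive_neq0 x_gt0).
(* The scale is the largest [n] that divides [x] within [Oplus]; [c] bounds all such [n]. *)
pose divides n := `[< (0 < n)%N /\ exists2 y : K, Oplus y & x = n%:R * y >].
have divides_le n : divides n -> (n <= `|c|)%N.
  move/asboolP=> [n0 [y [int_y _] def_x]].
  apply: (@integral_divisor_le c n (y * w)) => //; first exact: integral_mul.
  by rewrite def_c def_x mulrA.
have divides_1 : exists n, divides n.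
  by exists 1%N; apply/asboolP; split=> //; exists x; rewrite ?mul1r.
case: (ex_maxnP divides_1 divides_le) => s /asboolP[s0 [t Ot def_x]] s_max.
exists s, t; split=> //; split=> // m m2 [y Oy def_t].
have : divides (s * m)%N.
  apply/asboolP; split; first by rewrite muln_gt0 s0; lia.
  by exists y; rewrite // natrM -mulrA -def_t.
by move/s_max; nia.
Qed.

(* With [u a - v b = 1], the quotient [t1 / b] equals [u t2 - v t1]. *)
Lemma primitive_coprime_eq1 a b (t1 t2 : K) : (0 < a)%N -> (0 < b)%N ->
  coprime a b -> primitive t1 -> Oplus t2 -> a%:R * t1 = b%:R * t2 -> b = 1%N.
Proof.
move=> a0 b0 co_ab [[int1 t1_gt0] t1_prim] [int2 _] eq_ab.
have [u v def_uv _] := egcdnP b a0.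
rewrite (eqP co_ab) in def_uv.
pose z := u%:R * t2 - v%:R * t1.
have def_t1 : t1 = b%:R * z.
  rewrite /z mulrBr ![b%:R * _]mulrCA -eq_ab !mulrA -mulrBl -!natrM def_uv natrD.
  by rewrite [(b * v)%N]mulnC addrAC subrr add0r mul1r.
have Oz : Oplus z.
  split; last by apply/(totally_positiveM_nat _ b0); rewrite -def_t1.
  by apply: integral_sub; apply: integral_mul => //; apply: integral_nat.
have [b1|b2] : b = 1%N \/ (2 <= b)%N by lia.
  by [].
by case: (t1_prim b b2); exists z.
Qed.

(** Dividing the scales by their gcd makes them coprime, and then primitivity on each side forces
    both quotients to be 1. *)
Lemma scale_primitive_unique s1 s2 (t1 t2 : K) :
    (0 < s1)%N -> (0 < s2)%N -> primitive t1 -> primitive t2 ->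
  s1%:R * t1 = s2%:R * t2 -> s1 = s2 /\ t1 = t2.
Proof.
move=> s10 s20 prim1 prim2 eq_s.
have g0 : (0 < gcdn s1 s2)%N by rewrite gcdn_gt0 s10.
have [a def_a] := dvdnP (dvdn_gcdl s1 s2); have [b def_b] := dvdnP (dvdn_gcdr s1 s2).
have a0 : (0 < a)%N by move: s10; rewrite def_a muln_gt0 => /andP[].
have b0 : (0 < b)%N by move: s20; rewrite def_b muln_gt0 => /andP[].
have co_ab : coprime a b.
  by rewrite /coprime -(eqn_pmul2r g0) muln_gcdl -def_a -def_b mul1n.
have eq_ab : a%:R * t1 = b%:R * t2.
  apply: (mulfI (natr_neq0 g0)); rewrite !mulrA -!natrM ![(gcdn _ _ * _)%N]mulnC.
  by rewrite -def_a -def_b.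
have b1 : b = 1%N by apply: primitive_coprime_eq1 eq_ab => //; case: prim2.
have a1 : a = 1%N.
  by apply: primitive_coprime_eq1 (esym eq_ab); rewrite 1?coprime_sym //; case: prim1.
split; first by rewrite def_a [RHS]def_b a1 b1.
by move: eq_ab; rewrite a1 b1 !mul1r.
Qed.

Lemma scale_primitiveM s (t : K) : (0 < s)%N -> primitive t ->
  scale_primitive (s%:R * t) = (s, t).
Proof.
move=> s0 prim_t; apply: xget_unique => // -[s' t'] /= [s'0 prim_t' eq_s].
by have [-> ->] := scale_primitive_unique s0 s'0 prim_t prim_t' eq_s.
Qed.

Lemma Oplus_decomposition (x : K) : Oplus x ->
  [/\ (0 < scale x)%N, primitive (primitive_factor x)
     & x = (scale x)%:R * primitive_factor x].
Proof.
move=> /scale_primitive_exists[s [t [s0 prim_t ->]]].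
by rewrite /scale /primitive_factor scale_primitiveM.
Qed.

End NumberField.

(** * Section-wise transport of partitions *)

Section SectionScales.
Local Open Scope ring_scope.
Variable K : fieldExtType rat.
Implicit Types (l m : seq K) (t x : K).

Definition all_Oplus l := forall x, x \in l -> Oplus x.

(** The integer partition attached to the primitive element [t]. *)
Definition section_scales l t : seq nat :=
  [seq scale x | x <- l & primitive_factor x == t].

Definition assemble (h : K -> seq nat) (ts : seq K) : seq K :=
  flatten [seq [seq n%:R * t | n <- h t] | t <- ts].

(** An element of [Oplus] is determined by its scale and primitive factor. *)
Lemma count_section_scales l x : all_Oplus l -> Oplus x ->
  count_mem x l = count_mem (scale x) (section_scales l (primitive_factor x)).
Proof.
move=> Ol Ox; rewrite count_map count_filter; apply: eq_in_count => y /Ol Oy /=.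
apply/eqP/andP => [-> //|[/eqP eq_s /eqP eq_t]].
by have [_ _ ->] := Oplus_decomposition Oy; have [_ _ ->] := Oplus_decomposition Ox;
  rewrite eq_s eq_t.
Qed.

Lemma perm_by_sections l m : all_Oplus l -> all_Oplus m ->
  (forall t, perm_eq (section_scales l t) (section_scales m t)) -> perm_eq l m.
Proof.
move=> Ol Om eq_lm; apply/allP => x /=; rewrite mem_cat => xlm.
have Ox : Oplus x by case/orP: xlm => [/Ol|/Om].
by rewrite !count_section_scales // (permP (eq_lm _)).
Qed.

Lemma perm_section_scales l m t :
  perm_eq l m -> perm_eq (section_scales l t) (section_scales m t).
Proof. by move=> lm; apply/perm_map/perm_filter. Qed.

Lemma section_scales_gt0 l t : all_Oplus l -> 0%N \notin section_scales l t.
Proof.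
move=> Ol; apply/mapP=> -[x]; rewrite mem_filter => /andP[_ /Ol Ox] s0.
by have [] := Oplus_decomposition Ox; rewrite -s0.
Qed.

Lemma section_scales_nil l t :
  t \notin [seq primitive_factor x | x <- l] -> section_scales l t = [::].
Proof.
move=> t_l; rewrite /section_scales; apply/eqP; rewrite -size_eq0 size_map size_filter.
rewrite -leqn0 leqNgt -has_count; apply/hasPn => x x_l.
by apply: contraNneq t_l => <-; apply: map_f.
Qed.

Lemma scaleM n t : (0 < n)%N -> primitive t ->
  scale (n%:R * t) = n /\ primitive_factor (n%:R * t) = t.
Proof. by move=> n0 pt; rewrite /scale /primitive_factor scale_primitiveM. Qed.

Variables (ts : seq K) (h : K -> seq nat).
Hypothesis (prim_ts : forall t, t \in ts -> primitive t).
Hypothesis (h_gt0 : forall t, t \in ts -> 0%N \notin h t).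

Lemma assemble_Oplus : all_Oplus (assemble h ts).
Proof.
move=> x /flattenP[_ /mapP[t t_ts ->] /mapP[n n_h ->]].
have n0 : (0 < n)%N by rewrite lt0n; apply: contraNneq (h_gt0 t_ts) => <-.
by apply: Oplus_muln => //; have [] := prim_ts t_ts.
Qed.

Lemma sum_assemble : \sum_(x <- assemble h ts) x = \sum_(t <- ts) (sumn (h t))%:R * t.
Proof.
rewrite /assemble big_flatten big_map; apply: eq_bigr => t _.
by rewrite big_map -mulr_suml -natr_sum -sumnE.
Qed.

(** The multiples of [t] produced from [h t] all lie in the section of [t], so blocks for distinct
    primitive elements do not mix. *)
Lemma section_scales_assemble t : uniq ts ->
  section_scales (assemble h ts) t = if t \in ts then h t else [::].
Proof.
rewrite /section_scales /assemble.
elim: ts prim_ts h_gt0 => //= u us IH prim_us h0 /andP[u_us us_uniq].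
rewrite filter_cat map_cat IH //; first last.
- by move=> v v_us; apply: h0; rewrite inE v_us orbT.
- by move=> v v_us; apply: prim_us; rewrite inE v_us orbT.
have scale_u n : n \in h u ->
    scale (n%:R * u) = n /\ primitive_factor (n%:R * u) = u.
  move=> n_h; apply: scaleM; last by apply: prim_us; rewrite mem_head.
  by rewrite lt0n; apply: contraNneq (h0 u (mem_head _ _)) => <-.
rewrite inE eq_sym filter_map -map_comp.
have [<-|u_t] /= := eqVneq u t.
  rewrite (negPf u_us) cats0 (@eq_in_filter _ _ predT) => [|n /scale_u[_ /= ->]]; last exact: eqxx.
  rewrite filter_predT -[RHS]map_id.
  by apply/eq_in_map => n /scale_u[].
rewrite (@eq_in_filter _ _ pred0) => [|n /scale_u[_ /= ->]]; last exact: negPf.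
by rewrite filter_pred0.
Qed.

End SectionScales.

(** * Applying a weight-preserving map in every section *)

Section Transport.
Local Open Scope ring_scope.
Variable K : fieldExtType rat.
Implicit Types (l m : seq K) (t x : K).

Definition sections l : seq K := undup [seq primitive_factor x | x <- l].

Definition transport (f : seq nat -> seq nat) l : seq K :=
  assemble (fun t => f (section_scales l t)) (sections l).

Definition partition_with (P : pred (seq nat)) l :=
  all_Oplus l /\ forall t, P (section_scales l t).

Lemma sections_primitive l t : all_Oplus l -> t \in sections l -> primitive t.
Proof.
move=> Ol; rewrite mem_undup => /mapP[x /Ol Ox ->].
by have [] := Oplus_decomposition Ox.
Qed.

Lemma assemble_section_scales l : all_Oplus l ->
  perm_eq (assemble (section_scales l) (sections l)) l.
Proof.
move=> Ol; have prim_l t : t \in sections l -> primitive t by apply: sections_primitive.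
have gt0 t : t \in sections l -> 0%N \notin section_scales l t.
  by move=> _; apply: section_scales_gt0.
apply: perm_by_sections => //; first exact: assemble_Oplus.
move=> t; rewrite section_scales_assemble ?undup_uniq //; case: ifP => // t_l.
by rewrite section_scales_nil // -mem_undup -/(sections l) t_l.
Qed.

Variables (P Q : pred (seq nat)) (f g : seq nat -> seq nat).
Hypothesis (fP : weight_map P Q f g).
Hypothesis (Q_gt0 : forall s, Q s -> 0%N \notin s).

(** Weight 0 without zero parts forces the empty list. Sections absent from [l], over which
    [transport] does not run, thus agree with [f] too. *)
Lemma weight_map_nil : P [::] -> f [::] = [::].
Proof.
move=> /fP[Qf sum_f _ _]; have := Q_gt0 Qf; move: sum_f.
by case: (f [::]) => // n s /=; rewrite inE; lia.
Qed.

Lemma transport_Oplus l : partition_with P l -> all_Oplus (transport f l).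
Proof.
move=> [Ol Pl]; apply: assemble_Oplus => t; first exact: sections_primitive.
by move=> _; apply: Q_gt0; have [] := fP (Pl t).
Qed.

Lemma section_scales_transport l t : partition_with P l ->
  section_scales (transport f l) t = f (section_scales l t).
Proof.
move=> [Ol Pl]; rewrite section_scales_assemble ?undup_uniq //; first last.
- by move=> u _; apply: Q_gt0; have [] := fP (Pl u).
- by move=> u; apply: sections_primitive.
case: ifP => // t_l; have := Pl t; rewrite section_scales_nil => [/weight_map_nil //|].
by rewrite -mem_undup -/(sections l) t_l.
Qed.

Lemma transport_partition l : partition_with P l -> partition_with Q (transport f l).
Proof.
move=> Pl; split=> [|t]; first exact: transport_Oplus.
by rewrite section_scales_transport //; have [] := fP (Pl.2 t).
Qed.

(** Each section contributes [t] times the sum of its scales, which [f] preserves. *)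
Lemma sum_transport l : partition_with P l ->
  \sum_(x <- transport f l) x = \sum_(x <- l) x.
Proof.
move=> [Ol Pl]; rewrite -[RHS](perm_big _ (assemble_section_scales Ol)).
rewrite !sum_assemble; apply: eq_bigr => t _.
by have [_ -> _ _] := fP (Pl t).
Qed.

End Transport.

(** * Invertibility and permutation invariance of the transport *)

Section TransportInverse.
Variable K : fieldExtType rat.
Variables (P Q : pred (seq nat)) (f g : seq nat -> seq nat).
Hypotheses (fP : weight_map P Q f g) (gQ : weight_map Q P g f).
Hypotheses (P_gt0 : forall s, P s -> 0 \notin s) (Q_gt0 : forall s, Q s -> 0 \notin s).

Lemma transportK (l : seq K) : partition_with P l -> perm_eq (transport g (transport f l)) l.
Proof.
move=> Pl; have Qfl := transport_partition fP Q_gt0 Pl.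
apply: perm_by_sections; first exact: (transport_Oplus gQ P_gt0).
- by case: Pl.
- move=> t; rewrite (section_scales_transport gQ P_gt0) //.
  by rewrite (section_scales_transport fP Q_gt0) //; have [] := fP (Pl.2 t).
Qed.

(** Multisets enter through an enumeration, so the order of the list must not matter. *)
Lemma perm_transport (l m : seq K) : partition_with P l -> partition_with P m ->
  perm_eq l m -> perm_eq (transport f l) (transport f m).
Proof.
move=> Pl Pm lm; apply: perm_by_sections; do ?exact: (transport_Oplus fP Q_gt0).
move=> t; rewrite !(section_scales_transport fP Q_gt0) //.
have [_ _ _ f_perm] := fP (Pl.2 t).
by rewrite (f_perm _ (perm_section_scales t lm)).
Qed.

End TransportInverse.

(** * The bijection on multisets of totally positive integers *)

Section Conclusion.
Local Open Scope classical_set_scope.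
Local Open Scope card_scope.
Local Open Scope mset_scope.
Local Open Scope ring_scope.
Variable K : fieldExtType rat.
Implicit Types (l : seq K).

Definition partitions_with (P : pred (seq nat)) (delta : K) : set {mset K} :=
  [set lambda : {mset K} | partition_with P lambda /\ \sum_(x <- lambda) x = delta].

Lemma perm_partition_with P l m : perm_invariant P ->
  perm_eq l m -> partition_with P l -> partition_with P m.
Proof.
move=> permP lm [Ol Pl]; split=> [x|t]; first by rewrite -(perm_mem lm); apply: Ol.
by rewrite -(permP _ _ (perm_section_scales t lm)).
Qed.

Lemma card_partitions_with P Q f g (delta : K) :
    perm_invariant P -> perm_invariant Q ->
    weight_map P Q f g -> weight_map Q P g f ->
    (forall s, P s -> 0%N \notin s) -> (forall s, Q s -> 0%N \notin s) ->
  partitions_with P delta #= partitions_with Q delta.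
Proof.
move=> permP permQ fP gQ P0 Q0.
pose F (lambda : {mset K}) : {mset K} := seq_mset (transport f lambda).
pose G (lambda : {mset K}) : {mset K} := seq_mset (transport g lambda).
have F_perm (lambda : {mset K}) : perm_eq (transport f lambda) (F lambda).
  by rewrite perm_sym perm_eq_seq_mset.
have G_perm (lambda : {mset K}) : perm_eq (transport g lambda) (G lambda).
  by rewrite perm_sym perm_eq_seq_mset.
have FPQ (lambda : {mset K}) : partitions_with P delta lambda -> partitions_with Q delta (F lambda).
  move=> [Pl sum_l]; have Ql := transport_partition fP Q0 Pl; split.
    exact: perm_partition_with permQ (F_perm lambda) Ql.
  by rewrite -(perm_big _ (F_perm lambda)) (sum_transport fP).
have GQP (lambda : {mset K}) : partitions_with Q delta lambda -> partitions_with P delta (G lambda).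
  move=> [Ql sum_l]; have Pl := transport_partition gQ P0 Ql; split.
    exact: perm_partition_with permP (G_perm lambda) Pl.
  by rewrite -(perm_big _ (G_perm lambda)) (sum_transport gQ).
have FK (lambda : {mset K}) : partitions_with P delta lambda -> G (F lambda) = lambda.
  (* [F lambda] may enumerate [transport f lambda] in another order; [perm_transport] absorbs
     this. *)
  move=> Pl; have [Ql _] := FPQ _ Pl; rewrite -[RHS]seq_mset_id; apply/eq_seq_msetP.
  apply: perm_trans (transportK fP gQ P0 Q0 Pl.1).
  apply: (perm_transport gQ P0) => //; last by rewrite perm_sym.
  exact: (transport_partition fP Q0 Pl.1).
have GK (lambda : {mset K}) : partitions_with Q delta lambda -> F (G lambda) = lambda.
  move=> Ql; have [Pl _] := GQP _ Ql; rewrite -[RHS]seq_mset_id; apply/eq_seq_msetP.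
  apply: perm_trans (transportK gQ fP Q0 P0 Ql.1).
  apply: (perm_transport fP Q0) => //; last by rewrite perm_sym.
  exact: (transport_partition gQ P0 Ql.1).
have <- : F @` partitions_with P delta = partitions_with Q delta.
  apply/seteqP; split=> [_ [lambda Pl <-]|mu Qmu]; first exact: FPQ.
  by exists (G mu); [apply: GQP | apply: GK].
rewrite card_eq_sym; apply: inj_card_eq => lambda mu /set_mem Pl /set_mem Pm eq_F.
by rewrite -(FK _ Pl) eq_F FK.
Qed.

Lemma partitions_with_mod5 (delta : K) :
  [set lambda : {mset K} | is_partition delta lambda /\ scales_1_or_4_mod_5 lambda]
  = partitions_with mod5_partition delta.
Proof.
apply/seteqP; split=> lambda /=.
  case=> -[Ol sum_l] s5; split=> //; split=> // t.
  apply/allP=> _ /mapP[x + ->]; rewrite mem_filter => /andP[_ /s5].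
  by rewrite /mod5_part => -[] ->.
case=> -[Ol Pl] sum_l; split=> // x x_l.
have : mod5_part (scale x).
  apply: (allP (Pl (primitive_factor x))).
  by apply: map_f; rewrite mem_filter eqxx.
by case/orP=> /eqP s_x; [left | right].
Qed.

Definition dist2 : rel nat := fun m n => (2 <= `|m%:Z - n%:Z|)%N.

(** [dist2] fails exactly for equal or consecutive numbers. *)
Lemma pairwise_dist2 s :
  pairwise dist2 s = uniq s && all (fun n => n.+1 \notin s) s.
Proof.
elim: s => //= m s ->; apply/idP/idP.
  case/and3P=> /allP far_m s_uniq /allP s_far; rewrite s_uniq andbT.
  apply/and3P; split.
  - by apply/negP=> /far_m; rewrite /dist2; lia.
  - by rewrite inE negb_or; apply/andP; split; [lia | apply/negP=> /far_m; rewrite /dist2; lia].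
  apply/allP=> n n_s; rewrite inE negb_or s_far // andbT.
  by have := far_m n n_s; rewrite /dist2; lia.
case/andP=> /andP[m_s s_uniq] /andP[mS /allP s_far]; rewrite s_uniq /=; apply/andP; split.
  apply/allP=> n n_s; have := s_far n n_s; rewrite inE negb_or => /andP[nm _].
  have ne_nm : n != m by apply: contraNneq m_s => <-.
  have ne_nmS : n != m.+1.
    by apply: contraNneq mS => <-; rewrite inE n_s orbT.
  by rewrite /dist2; move: nm ne_nm ne_nmS; lia.
by apply/allP=> n /s_far; rewrite inE negb_or => /andP[].
Qed.

Lemma pairwise_sections (r : rel nat) l :
  pairwise (fun x y => (primitive_factor x == primitive_factor y) ==> r (scale x) (scale y)) l
  <-> forall t, pairwise r (section_scales l t).
Proof.
rewrite /section_scales; elim: l => //= x l IH; split.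
  case/andP=> /allP x_l /IH l_r t; case: ifP => //= /eqP x_t.
  rewrite l_r andbT; apply/allP=> _ /mapP[y + ->]; rewrite mem_filter.
  by case/andP=> /eqP y_t /x_l; rewrite x_t y_t eqxx.
move=> l_r; apply/andP; split; last first.
  by apply/IH => t; have := l_r t; case: ifP => //= _ /andP[].
apply/allP=> y y_l; apply/implyP=> /eqP xy; have := l_r (primitive_factor x).
rewrite eqxx /= => /andP[/allP + _]; apply.
by apply: map_f; rewrite mem_filter xy eqxx.
Qed.

(** The condition for [a <> b] is symmetric, so the case [a < b], which [pairwise] tests,
    suffices. *)
Lemma section_scales_2_apartP (lambda : {mset K}) :
  section_scales_2_apart lambda <-> forall t, pairwise dist2 (section_scales lambda t).
Proof.
rewrite -pairwise_sections; split=> [apart|/(pairwiseP 0) apart a b a_l b_l].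
  apply/(pairwiseP 0) => a b a_l b_l lt_ab; apply/implyP => /eqP eq_t.
  by apply: apart => //; lia.
case: (ltngtP a b) => // [lt_ab|lt_ba] _ eq_t.
  by have /implyP := apart a b a_l b_l lt_ab; apply; apply/eqP; exact: eq_t.
have /implyP := apart b a b_l a_l lt_ba; rewrite /dist2 distnC; apply.
by apply/eqP; exact: esym eq_t.
Qed.

Lemma partitions_with_gap (delta : K) :
  [set lambda : {mset K} | is_partition delta lambda /\ section_scales_2_apart lambda]
  = partitions_with gap_partition delta.
Proof.
apply/seteqP; split=> lambda /=.
  case=> -[Ol sum_l] /section_scales_2_apartP apart; split=> //; split=> // t.
  have gt0 := @section_scales_gt0 _ lambda t Ol.
  by rewrite /gap_partition gt0 -pairwise_dist2 apart.
case=> -[Ol Pl] sum_l; split=> //; apply/section_scales_2_apartP => t.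
by rewrite pairwise_dist2; have /andP[] := Pl t.
Qed.

End Conclusion.

Local Open Scope classical_set_scope.
Local Open Scope card_scope.
Local Open Scope mset_scope.

Theorem corollary3p9 (K : fieldExtType rat) (hK : totally_real K)
    (delta : K) (hdelta : Oplus delta) :
  [set lambda : {mset K} |
    is_partition delta lambda /\ scales_1_or_4_mod_5 lambda]
  #=
  [set lambda : {mset K} |
    is_partition delta lambda /\ section_scales_2_apart lambda].
Proof.
rewrite partitions_with_mod5 partitions_with_gap.
have [f [g [fP gQ]]] := rogers_ramanujan_bijection.
apply: (card_partitions_with _ perm_mod5 perm_gap fP gQ) => s; last by case/and3P.
(* [mod5_part 0] is false, so no part is 0. *)
by move=> /allP s5; apply/negP=> /s5.
Qed.
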